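(* Let $k\ge 3$ be any fixed integer, and let $\mathcal{F}$ be any family of graphs that contains $K_2$. If there is a threshold $n_0$ such that $\max\{e(D) : D\in\mathcal{F},\ |V(D)|=n\}<n^2/k^2$ holds for every $n>n_0$, then there exist infinitely many graphs $G$ with $\chi_{\mathcal{F}}(G)=\chi(G)=k$, and all those $G$ (i.e. all graphs $G$ with $\chi_{\mathcal{F}}(G)=\chi(G)=k$) satisfy $$\mathrm{ex}(n,K_k)+2\le f(n,G|\mathcal{F})\le (1+o(1))\,\mathrm{ex}(n,K_k),$$ where $o(1)\to0$ as $n\to\infty$.
   Context: Families of graphs consist of finite graphs without isolated vertices and are closed under isomorphism. $e(D)$ is the number of edges of $D$, and $\chi$ is the chromatic number. $\chi_{\mathcal{F}}(G):=\min\{\chi(G-D) : D\subset G,\ D\in\mathcal{F}\}$, where $D$ ranges over the subgraphs of $G$ belonging to $\mathcal{F}$ and $G-D$ is obtained from $G$ by removing the edges of $D$. $\mathrm{ex}(n,F)$ is the Turán number: the maximum number of edges in a graph of order $n$ containing no subgraph isomorphic to $F$. In an edge coloring of $K_n$ (not necessarily proper), for a copy $G'\subseteq K_n$ of a graph $G$, a color class of $G'$ is the graph (without isolated vertices) formed by all edges of $G'$ having a given color that occurs in $G'$. If $K_2\in\mathcal{F}$ and $n\ge |G|$, $f(n,G|\mathcal{F})$ is the smallest integer $m$ such that in every edge coloring of $K_n$ using at least $m$ colors there exists a copy of $G$ in which all color classes are members of $\mathcal{F}$. *)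

(* Defs.v *)
From HB Require Import structures.
From mathcomp Require Import all_boot all_order all_algebra.
From mathcomp Require Import all_classical all_reals all_analysis.
Set Implicit Arguments.
Unset Strict Implicit.
Unset Printing Implicit Defensive.

Local Open Scope classical_set_scope.
Local Open Scope nat_scope.

(* Least element of a set of naturals; 0 (junk) on the empty set. *)
Definition nat_min (A : set nat) : nat :=
  if pselect (exists n, `[< A n >]) is left exA then ex_minn exA else 0.

(* Finite simple graphs; an edge is a two-element set of vertices. *)
Record sgraph := SGraph {
  vertex :> finType;
  edges : {set {set vertex}};
  edges_card2 : [forall e in edges, #|e| == 2]
}.

Fact mkgraph_subproof (V : finType) (E : {set {set V}}) :
  [forall e in [set e in E | #|e| == 2]%SET, #|e| == 2].
Proof. by apply/forall_inP => e; rewrite inE => /andP[]. Qed.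

(* Members of E that are not two-element sets are discarded, so that the
   definition is total. *)
Definition mkgraph (V : finType) (E : {set {set V}}) : sgraph :=
  SGraph (mkgraph_subproof E).

Definition complete (n : nat) : sgraph := mkgraph [set: {set 'I_n}]%SET.

Definition isomorphic (G H : sgraph) : Prop :=
  exists f : G -> H,
    bijective f /\ edges H = [set f @: e | e : {set G} in edges G]%SET.

Definition no_isolated (G : sgraph) : Prop :=
  forall x : G, exists2 e : {set G}, e \in edges G & x \in e.

Definition graph_family (F : sgraph -> Prop) : Prop :=
  (forall G, F G -> no_isolated G) /\
  (forall G H, isomorphic G H -> F G -> F H).

(* The graph without isolated vertices whose edge set is D: its vertices are
   the ends of the members of D. *)
Definition spanned (V : finType) (D : {set {set V}}) : sgraph :=
  @mkgraph {x : V | x \in finset.cover D}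
    [set e : {set {x : V | x \in finset.cover D}} | (val @: e)%SET \in D]%SET.

Definition delete_edges (G : sgraph) (D : {set {set G}}) : sgraph :=
  mkgraph (edges G :\: D)%SET.

Definition proper_coloring (G : sgraph) (T : Type) (c : G -> T) : Prop :=
  forall x y : G, [set x; y]%SET \in edges G -> c x <> c y.

Definition chi (G : sgraph) : nat :=
  nat_min [set m | exists c : G -> 'I_m, proper_coloring c].

(* As the members of F have no isolated vertices, a subgraph of G that belongs
   to F is determined by its edge set D. *)
Definition chiF (F : sgraph -> Prop) (G : sgraph) : nat :=
  nat_min [set chi (delete_edges D) |
            D in [set D : {set {set G}} | D \subset edges G /\ F (spanned D)]].

Definition contains (G H : sgraph) : Prop :=
  exists h : H -> G,
    injective h /\ forall e : {set H}, e \in edges H -> (h @: e)%SET \in edges G.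

Definition turan (n : nat) (H : sgraph) : nat :=
  \max_(E : {set {set 'I_n}} | `[< ~ contains (mkgraph E) H >])
     #|edges (mkgraph E)|.

(* The maximum of e(D) over D in F with |V(D)| = n; as F is closed under
   isomorphism, it is enough to consider the D with vertex set 'I_n. *)
Definition max_edges (F : sgraph -> Prop) (n : nat) : nat :=
  \max_(E : {set {set 'I_n}} | `[< F (mkgraph E) >]) #|edges (mkgraph E)|.

(* An edge colouring of K_n is a map c : {set 'I_n} -> nat, of which only the
   values at the edges of K_n are relevant. *)
Definition num_colors (n : nat) (c : {set 'I_n} -> nat) : nat :=
  size (undup [seq c e | e in edges (complete n)]).

Definition copy_edges (n : nat) (G : sgraph) (h : G -> 'I_n) :
    {set {set 'I_n}} := [set h @: e | e : {set G} in edges G]%SET.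

Definition color_class (n : nat) (c : {set 'I_n} -> nat) (G : sgraph)
    (h : G -> 'I_n) (a : nat) : {set {set 'I_n}} :=
  [set e in copy_edges h | c e == a]%SET.

Definition fcol (n : nat) (G : sgraph) (F : sgraph -> Prop) : nat :=
  nat_min [set m | forall c : {set 'I_n} -> nat, m <= num_colors c ->
    exists h : G -> 'I_n, injective h /\
      forall e, e \in copy_edges h -> F (spanned (color_class c h (c e)))].

(* Main.v *)
Require Import Defs.
From HB Require Import structures.
From mathcomp Require Import all_boot all_order all_algebra.
From mathcomp Require Import all_classical all_reals all_analysis.
From mathcomp Require Import zify ring.
Set Implicit Arguments.
Unset Strict Implicit.
Unset Printing Implicit Defensive.
Import Order.TTheory GRing.Theory Num.Theory.
Import numFieldNormedType.Exports.
From mathcomp Require Import fintype finset.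
Local Open Scope nat_scope.

(** Write k = r + 1.

    Infinitely many graphs.  Take the complete k-partite graph with p vertices
    in each part, for a prime p >= k.  Its vertices are the points (i, y) of a
    k by p grid over the field with p elements, and the p^2 lines y = a + i b
    are p^2 pairwise edge-disjoint copies of K_k, because two points in distinct
    columns lie on one line ([line_avoiding]).  A member of F inside this graph
    has at most kp vertices, hence by sparsity fewer than (kp)^2 / k^2 = p^2
    edges as soon as p exceeds the threshold; it misses one of these copies, so
    deleting it does not lower the chromatic number
    ([chiF_big_multipartite]).

    Lower bound.  By Turan's theorem some r-partition of the n vertices has at
    least ex(n, K_k) crossing edges ([turan_le_cross]).  Give the crossing edges
    distinct colours and all the other edges one further colour; that is
    ex(n, K_k) + 1 colours.  If every colour class of a copy of G were in F,
    then so would be the set D of its non-crossing edges, but G - D is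
    r-colourable by the parts, against chi_F(G) = k; and if D is empty, then G
    itself is r-colourable ([fcol_lower]).

    Upper bound.  Choose one edge of each colour.  If there are noticeably more
    than ex(n, K_k) of them, the theorem of Erdos and Stone
    ([erdos_stone]) yields a complete k-partite graph with |G| vertices in each
    part among these edges.  As chi(G) = k, it contains a copy of G, all of
    whose colour classes are single edges, hence in F ([fcol_upper]).

    Turan's theorem is proved by degree majorization, and the theorem of Erdos
    and Stone by induction on the number of parts for graphs of large minimum
    degree, to which the general case is reduced by deleting vertices.  Densities
    are measured by counting non-neighbours: a graph on n vertices has density
    above 1 - 1/r when its n^2 ordered pairs of vertices contain at most
    (1 - 1/q) n^2 / r non-adjacent ones, for some q.  Both the statements and
    the arithmetic then stay in the natural numbers. *)

(** * Edge sets, minima and chromatic numbers *)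

(** The complete multipartite graph whose parts are the fibres of c. *)
Definition cross (V : finType) (T : eqType) (c : V -> T) : {set {set V}} :=
  [set [set p.1; p.2] | p : V * V & c p.1 != c p.2].

Lemma set2_eq (V : finType) (x y a b : V) :
  [set x; y] = [set a; b] -> (x = a /\ y = b) \/ (x = b /\ y = a).
Proof.
move=> E; have /setP Ex := E.
have := Ex x; have := Ex y; have := Ex a; have := Ex b.
rewrite !inE !eqxx ?orbT /= => /orP hb /orP ha /esym /orP hy /esym /orP hx.
case: hx => /eqP hx; case: hy => /eqP hy; subst; auto.
  by case: hb => /eqP ->; auto.
by case: ha => /eqP ->; auto.
Qed.

Lemma in_cross (V : finType) (T : eqType) (c : V -> T) (x y : V) :
  ([set x; y] \in cross c) = (c x != c y).
Proof.
apply/imsetP/idP => [[[a b] /=]|h]; last by exists (x, y); rewrite ?inE.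
by rewrite inE /= => h /set2_eq [[-> ->]|[-> ->]] //; rewrite eq_sym.
Qed.

Lemma card_cross (V : finType) (T : eqType) (c : V -> T) (A : {set V}) :
  A \in cross c -> #|A| = 2.
Proof.
case/imsetP => -[a b]; rewrite inE /= => h ->; rewrite cards2.
by have -> : a != b by apply: contraNneq h => ->.
Qed.

Lemma edges_mkgraph (V : finType) (E : {set {set V}}) :
  (forall A, A \in E -> #|A| = 2) -> edges (mkgraph E) = E.
Proof. by move=> h; apply/setP => A; rewrite inE andb_idr // => /h ->. Qed.

Lemma card_edge (G : sgraph) (A : {set G}) : A \in edges G -> #|A| = 2.
Proof. by move=> hA; have /forall_inP/(_ _ hA)/eqP := edges_card2 G. Qed.

Lemma imset_set2 (V W : finType) (h : V -> W) (x y : V) :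
  h @: [set x; y] = [set h x; h y].
Proof. by rewrite imsetU !imset_set1. Qed.

Lemma edgeP (G : sgraph) (A : {set G}) : A \in edges G ->
  exists x y : G, x != y /\ A = [set x; y].
Proof. by move/card_edge/eqP/cards2P. Qed.

Lemma edge_neq (G : sgraph) (x y : G) : [set x; y] \in edges G -> x != y.
Proof.
by move=> xy; apply/eqP => E; have := card_edge xy; rewrite E setUid cards1.
Qed.

Lemma handshake (V : finType) (E : {set {set V}}) :
  (forall A, A \in E -> #|A| = 2) ->
  \sum_(x : V) #|[set y | [set x; y] \in E]| = 2 * #|E|.
Proof.
move=> E2.
have deg x : #|[set y | [set x; y] \in E]| = \sum_(A in E) (x \in A).
  rewrite -(card_in_imset (f := fun y => [set x; y])); last first.
    by move=> y z _ _ /set2_eq [[]|[]] // <- ->.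
  rewrite -big_mkcondr /= sum1_card; apply: eq_card => A; rewrite [RHS]inE.
  apply/imsetP/andP => [[y]|[AE xA]]; first by rewrite inE => h ->; rewrite set21.
  have /eqP/cards2P[a [b [nab eA]]] := E2 _ AE; move: xA; rewrite eA !inE.
  case/orP => /eqP ->; first by exists b; rewrite ?inE -?eA.
  by exists a; rewrite ?inE setUC -?eA.
under eq_bigr do rewrite deg.
rewrite exchange_big /= mulnC -sum_nat_const; apply: eq_bigr => A /E2 <-.
by rewrite -sum1_card [RHS]big_mkcond; apply: eq_bigr => x _; case: (_ \in _).
Qed.

Lemma nat_minP (A : set nat) : (exists n, A n) ->
  A (nat_min A) /\ forall m, A m -> nat_min A <= m.
Proof.
move=> [n An]; rewrite /nat_min; case: pselect => [exA|nA]; last first.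
  by exfalso; apply: nA; exists n; apply/asboolP.
by case: ex_minnP => m /asboolP Am mi; split => // p Ap; apply/mi/asboolP.
Qed.

Lemma nat_min_le (A : set nat) m : A m -> nat_min A <= m.
Proof. by move=> Am; have [|_] := @nat_minP A; [exists m|exact]. Qed.

Lemma chiP (G : sgraph) : exists c : G -> 'I_(chi G), proper_coloring c.
Proof.
have [|//] := @nat_minP [set m | exists c : G -> 'I_m, proper_coloring c]%classic.
exists #|G|, enum_rank => x y xy /enum_rank_inj E.
by have := card_edge xy; rewrite E setUid cards1.
Qed.

Lemma chi_le (G : sgraph) m (c : G -> 'I_m) : proper_coloring c -> chi G <= m.
Proof. by move=> cp; apply: nat_min_le; exists c. Qed.

Lemma chi_le_card (G : sgraph) : chi G <= #|G|.
Proof.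
apply: (@chi_le _ _ enum_rank) => x y xy /enum_rank_inj E.
by have := card_edge xy; rewrite E setUid cards1.
Qed.

Lemma chiF_le F (G : sgraph) (D : {set {set G}}) :
  D \subset edges G -> F (spanned D) -> chiF F G <= chi (delete_edges D).
Proof. by move=> DG FD; apply: nat_min_le; exists D. Qed.

Lemma edges_delete (G : sgraph) (D : {set {set G}}) :
  edges (delete_edges D) = edges G :\: D.
Proof. by apply: edges_mkgraph => A /setDP[/card_edge]. Qed.

(** * Graphs spanned by an edge set *)

Lemma edges_spanned (V : finType) (D : {set {set V}}) :
  (forall A, A \in D -> #|A| = 2) ->
  edges (spanned D) = [set e : {set {x : V | x \in cover D}} | val @: e \in D].
Proof.
by move=> D2; apply: edges_mkgraph => A; rewrite inE => /D2 <-; rewrite (card_imset _ val_inj).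
Qed.

Lemma val_preimset (V : finType) (D : {set {set V}}) (A : {set V}) : A \in D ->
  val @: [set x : {x : V | x \in cover D} | val x \in A] = A.
Proof.
move=> AD; apply/setP => x; apply/imsetP/idP => [[y]|xA]; first by rewrite inE => h ->.
have xc : x \in cover D by apply/bigcupP; exists A.
by exists (exist _ x xc); rewrite ?inE.
Qed.

Lemma card_edges_spanned (V : finType) (D : {set {set V}}) :
  (forall A, A \in D -> #|A| = 2) -> #|edges (spanned D)| = #|D|.
Proof.
move=> D2; rewrite edges_spanned //.
rewrite -(card_imset (f := fun e : {set _} => val @: e) _ (imset_inj val_inj)).
apply: eq_card => A; apply/imsetP/idP => [[e]|AD]; first by rewrite inE => h ->.
exists [set x : {x : V | x \in cover D} | val x \in A]; last by rewrite val_preimset.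
by rewrite inE val_preimset.
Qed.

(** Membership in a family is transported by this isomorphism between a
    subgraph of G and its image in a copy of G. *)
Lemma isomorphic_spanned (V W : finType) (h : V -> W) (D : {set {set V}}) :
  injective h -> (forall A, A \in D -> #|A| = 2) ->
  isomorphic (spanned D) (spanned [set h @: A | A : {set V} in D]).
Proof.
move=> hi D2.
have D2' B : B \in [set h @: A | A : {set V} in D] -> #|B| = 2.
  by case/imsetP => A /D2 <- ->; rewrite card_imset.
have inc (x : V) : x \in cover D -> h x \in cover [set h @: A | A : {set V} in D].
  case/bigcupP => A AD xA; apply/bigcupP; exists (h @: A); last exact: imset_f.
  exact: imset_f.
pose f (x : {x : V | x \in cover D}) :
  {x : W | x \in cover [set h @: A | A : {set V} in D]} :=
  exist (fun y : W => y \in cover [set h @: A | A : {set V} in D])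
    (h (val x)) (inc _ (valP x)).
have fi : injective f by move=> x y /(congr1 val) /= /hi /val_inj.
exists f; split.
  apply: inj_card_bij => //.
  rewrite -(card_imset predT fi); apply: subset_leq_card; apply/subsetP => -[y yc] _.
  have /bigcupP[B /imsetP[A AD ->] /imsetP[x xA E]] := yc.
  have xc : x \in cover D by apply/bigcupP; exists A.
  by apply/imsetP; exists (exist _ x xc) => //; apply/val_inj.
have vf (e : {set {x : V | x \in cover D}}) : val @: (f @: e) = h @: (val @: e).
  by rewrite -!imset_comp.
rewrite !edges_spanned //; apply/setP => B; rewrite inE.
apply/imsetP/imsetP => [[A AD E]|[e]]; last first.
  by rewrite inE => eD ->; exists (val @: e).
exists [set x : {x : V | x \in cover D} | val x \in A].
  by rewrite inE val_preimset.
by apply: (imset_inj val_inj); rewrite vf val_preimset.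
Qed.

Lemma isomorphic_sym (G H : sgraph) : isomorphic G H -> isomorphic H G.
Proof.
move=> [f [[g fK gK] HE]]; exists g; split; first by exists f.
have gfK (A : {set G}) : g @: (f @: A) = A.
  by rewrite -imset_comp (eq_imset _ (g := id)) ?imset_id.
rewrite HE; apply/setP => A; apply/idP/imsetP => [AG|[B /imsetP[C CG ->] ->]].
  by exists (f @: A); rewrite ?gfK ?imset_f.
by rewrite gfK.
Qed.

Lemma isomorphic_complete2 (V : finType) (A : {set V}) : #|A| = 2 ->
  isomorphic (complete 2) (spanned [set A]).
Proof.
move=> A2.
have cA : cover [set A] = A by rewrite /cover big_set1.
have D2 B : B \in [set A] -> #|B| = 2 by move/set1P ->.
have inA i : enum_val (cast_ord (esym A2) i) \in cover [set A] by rewrite cA enum_valP.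
pose f (i : 'I_2) : {x : V | x \in cover [set A]} :=
  exist (fun x : V => x \in cover [set A]) _ (inA i).
have fi : injective f by move=> i j /(congr1 val) /= /enum_val_inj /cast_ord_inj.
have cf : #|{: {x : V | x \in cover [set A]}}| = 2.
  by rewrite card_sig -A2; apply: eq_card => x; rewrite inE cA.
exists f; split; first by apply: inj_card_bij => //; rewrite cf card_ord.
rewrite edges_spanned //; apply/setP => e; rewrite !inE; apply/eqP/imsetP => [E|[B]].
  exists [set: 'I_2]; first by rewrite !inE cardsT card_ord.
  have -> : e = [set: _].
    apply/eqP; rewrite eqEcard subsetT cardsT cf -(card_imset (mem e) val_inj) E A2 //.
  by apply/eqP; rewrite eq_sym eqEcard subsetT cardsT cf card_imset // cardsT card_ord.
rewrite !inE /= => /eqP B2 ->; apply/eqP; rewrite eqEcard card_imset; last exact: val_inj.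
rewrite card_imset // A2 B2 leqnn andbT; apply/subsetP => x /imsetP[y _ ->].
by rewrite -{2}cA; exact: valP y.
Qed.

Lemma family_single_edge F (V : finType) (A : {set V}) : graph_family F -> F (complete 2) ->
  #|A| = 2 -> F (spanned [set A]).
Proof. by move=> [_ Fi] F2 /isomorphic_complete2 /Fi; apply. Qed.

(** Numbering the vertices of G turns it into one of the graphs on 'I_#|G| over
    which the maximum is taken. *)
Lemma card_edges_le_max F (G : sgraph) : graph_family F -> F G ->
  #|edges G| <= max_edges F #|G|.
Proof.
move=> [_ Fi] FG.
pose E := [set enum_rank @: A | A : {set G} in edges G].
have cE A : A \in E -> #|A| = 2.
  by case/imsetP => B /card_edge <- ->; rewrite (card_imset _ enum_rank_inj).
have -> : #|edges G| = #|edges (mkgraph E)|.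
  by rewrite edges_mkgraph // card_imset //; apply/imset_inj/enum_rank_inj.
apply: (leq_bigmax_cond (F := fun E : {set {set 'I_#|G|}} => #|edges (mkgraph E)|)).
apply/asboolP; apply: Fi FG; exists enum_rank; split.
  exact: enum_rank_bij.
by rewrite edges_mkgraph.
Qed.

(** * Turan's theorem *)

(** Erdos's proof of Turan's theorem.  Let x have maximum degree in A.  Its
    neighbourhood B contains no clique of size r, so it can be coloured by
    induction; all of A :\: B receives a new colour.  A vertex of A :\: B then has
    #|B| vertices of other colours, which is the maximum degree, and a vertex of
    B gains all of A :\: B. *)
Lemma degree_majorization (V : finType) (e : rel V) (r : nat) (A : {set V}) :
  symmetric e -> irreflexive e ->
  (forall K : {set V}, K \subset A -> #|K| = r.+1 ->
     ~ {in K &, forall x y, x != y -> e x y}) ->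
  exists2 c : V -> nat, {in A, forall x, c x < r} &
    {in A, forall x, #|[set y in A | e x y]| <= #|[set y in A | c y != c x]|}.
Proof.
move=> esym eirr; elim: r A => [|r IH] A noK.
  have A0 : A = set0.
    apply/eqP; apply: contraT => /set0Pn[x xA]; exfalso.
    apply: (noK [set x]); rewrite ?sub1set ?cards1 //.
    by move=> y z /set1P -> /set1P ->; rewrite eqxx.
  by exists (fun _ => 0) => x; rewrite A0 inE.
have [->|/set0Pn[x0 x0A]] := eqVneq A set0.
  by exists (fun _ => 0) => x; rewrite inE.
case: (@arg_maxnP V x0 (fun x => x \in A) (fun x => #|[set y in A | e x y]|) x0A) => x xA xmax.
have [B BE] : exists B, B = [set y in A | e x y] by eexists.
have inB y : (y \in B) = (y \in A) && e x y by rewrite BE inE.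
rewrite -BE in xmax.
have BA : B \subset A by apply/subsetP => y; rewrite inB => /andP[].
have [K KB K1 Kc|c cr cdeg] := IH B.
  have exx : x \in K = false.
    by apply/negP => /(subsetP KB); rewrite inB eirr andbF.
  apply: (noK (x |: K)); first by rewrite subUset sub1set xA (subset_trans KB BA).
    by rewrite cardsU1 exx K1.
  have adj y : y \in K -> e x y by move/(subsetP KB); rewrite inB => /andP[].
  move=> y z /setU1P[->|yK] /setU1P[->|zK]; rewrite ?eqxx //.
  - by move=> _; apply: adj.
  - by move=> _; rewrite esym; apply: adj.
  - exact: Kc.
exists (fun y => if y \in B then c y else r) => [y _|y yA].
  by case: ifP => // /cr/ltnW.
case: ifPn => yB.
  apply: leq_trans (_ : #|[set z in B | c z != c y] :|: (A :\: B)| <= _).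
    rewrite cardsU (_ : _ :&: _ = set0) ?cards0 ?subn0; last first.
      by apply/setP => z; rewrite !inE; case: (z \in B); rewrite ?andbF.
    apply: leq_trans (_ : #|[set z in B | e y z] :|: (A :\: B)| <= _).
      apply: subset_leq_card; apply/subsetP => z.
      by rewrite !inE => /andP[-> ->]; case: (z \in B).
    by rewrite cardsU (leq_trans (leq_subr _ _)) // leq_add2r cdeg.
  apply: subset_leq_card; apply/subsetP => z /setUP[|/setDP[zA nzB]].
    by rewrite !inE => /andP[zB ?]; rewrite zB (subsetP BA).
  by rewrite inE zA (negbTE nzB) gtn_eqF // cr.
apply: leq_trans (xmax y yA) _; apply: subset_leq_card; apply/subsetP => z zB.
by rewrite inE (subsetP BA) // zB ltn_eqF // cr.
Qed.

Lemma sum_ord_const n c : \sum_(i < n) c = n * c.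
Proof. by rewrite big_const_ord iter_addn_0 mulnC. Qed.

Lemma contains_complete (V : finType) (E : {set {set V}}) k (h : 'I_k -> V) :
  injective h -> (forall i j, i != j -> [set h i; h j] \in E) ->
  contains (mkgraph E) (complete k).
Proof.
move=> hi hE; exists h; split=> // A /edgeP[i [j [ij ->]]].
by rewrite imset_set2 inE hE // cards2 (inj_eq hi) ij.
Qed.

(** Two of the k vertices of a clique would lie in the same part. *)
Lemma cross_complete_free (V : finType) r k (c : V -> 'I_r) : r < k ->
  ~ contains (mkgraph (cross c)) (complete k).
Proof.
move=> rk [h [hi hE]].
have cE : edges (mkgraph (cross c)) = cross c by apply/edges_mkgraph/card_cross.
have ci : injective (c \o h).
  move=> i j /= cij; apply/eqP; apply: contraT => ij.
  have ijK : [set i; j] \in edges (complete k) by rewrite !inE cards2 ij.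
  by have := hE _ ijK; rewrite imset_set2 cE in_cross cij eqxx.
by have := leq_card _ ci; rewrite !card_ord leqNgt rk.
Qed.

Lemma card_edges_le_cross (V : finType) (E : {set {set V}}) r : 0 < r ->
  ~ contains (mkgraph E) (complete r.+1) ->
  exists c : V -> 'I_r, #|edges (mkgraph E)| <= #|cross c|.
Proof.
case: r => // r _ free; set G := mkgraph E in free *.
pose e (x y : V) := [set x; y] \in edges G.
have esym : symmetric e by move=> x y; rewrite /e setUC.
have eirr : irreflexive e.
  by move=> x; apply/negP => /(@edge_neq G); rewrite eqxx.
have [K _ Kr Kc|c cr cdeg] := @degree_majorization V e r.+1 setT esym eirr.
  apply: free.
  pose v i := enum_val (cast_ord (Logic.eq_sym Kr) i).
  apply: (@contains_complete _ _ _ v) => [i j /enum_val_inj/cast_ord_inj //|i j ij].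
  have : e (v i) (v j).
    by apply: Kc; rewrite ?enum_valP // (inj_eq enum_val_inj) (inj_eq (@cast_ord_inj _ _ _)).
  by rewrite /e inE => /andP[].
pose c' x : 'I_r.+1 := inord (c x); exists c'.
have c'E x y : (c' x == c' y) = (c x == c y).
  by rewrite -val_eqE /= !inordK // cr ?inE.
rewrite -(leq_pmul2l (isT : 0 < 2)) -!handshake; first last.
- by move=> A /card_edge.
- by move=> A /card_cross.
apply: leq_sum => x _; have := cdeg x (in_setT x).
have -> : [set y in setT | e x y] = [set y | [set x; y] \in edges G].
  by apply/setP => y; rewrite in_set in_setT [RHS]in_set.
move/leq_trans; apply; apply: subset_leq_card; apply/subsetP => y.
by rewrite !inE in_cross c'E eq_sym.
Qed.

(** Turan's theorem: complete r-partite graphs attain the Turan number of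
    K_(r+1). *)
Lemma turan_le_cross n r : 0 < r ->
  exists c : 'I_n -> 'I_r, turan n (complete r.+1) <= #|cross c|.
Proof.
move=> r0; rewrite /turan.
apply: (big_ind (fun m => exists c : 'I_n -> 'I_r, m <= #|cross c|)).
- by exists (fun _ => Ordinal r0).
- move=> m1 m2 [c1 h1] [c2 h2]; case: (leqP m1 m2) => _; first by exists c2.
  by exists c1.
- by move=> E /asboolP; apply: card_edges_le_cross.
Qed.

Lemma cross_le_turan n r k (c : 'I_n -> 'I_r) : r < k ->
  #|cross c| <= turan n (complete k).
Proof.
move=> rk; have <- : edges (mkgraph (cross c)) = cross c by apply/edges_mkgraph/card_cross.
apply: (leq_bigmax_cond (F := fun E : {set {set 'I_n}} => #|edges (mkgraph E)|)).
exact/asboolP/cross_complete_free.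
Qed.

Lemma card_residue_class n r j : 0 < r -> r * #|[set y : 'I_n | y %% r == j]| <= n + r.
Proof.
move=> r0; apply: (@leq_trans (r * (n %/ r).+1)); last first.
  by rewrite mulnS addnC leq_add2r mulnC leq_trunc_div.
rewrite leq_mul2l; apply/orP; right.
have di (y : 'I_n) : y %/ r < (n %/ r).+1 by rewrite ltnS leq_div2r // ltnW.
rewrite -(card_in_imset (f := fun y : 'I_n => Ordinal (di y))).
  by apply: leq_trans (max_card _) _; rewrite card_ord.
move=> y z; rewrite !inE => /eqP yj /eqP zj [E]; apply/val_inj => /=.
by rewrite (divn_eq y r) (divn_eq z r) yj zj E.
Qed.

(** Counts the crossing edges of the partition of 'I_n into residue classes
    modulo r: each vertex shares its class with at most n / r + 1 vertices. *)
Lemma turan_lower n r : 0 < r ->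
  r * n ^ 2 <= 2 * (r * turan n (complete r.+1)) + n ^ 2 + r * n.
Proof.
case: r => // r _; pose c (x : 'I_n) : 'I_r.+1 := inord (x %% r.+1).
have cE x y : (c x == c y) = (x %% r.+1 == y %% r.+1).
  by rewrite -val_eqE /= !inordK // ltn_pmod.
apply: (@leq_trans (2 * (r.+1 * #|cross c|) + n ^ 2 + r.+1 * n)); last first.
  by rewrite !leq_add2r !leq_mul2l cross_le_turan.
rewrite mulnCA -handshake; last by move=> A /card_cross.
rewrite big_distrr /= -mulnn mulnA -[_ * n * n]mulnC -addnA -mulnDl -[(n + _) * n]mulnC.
rewrite -(sum_ord_const n (r.+1 * n)) -(sum_ord_const n (n + r.+1)).
rewrite -big_split /=; apply: leq_sum => x _.
rewrite -{1}(card_ord n) -(cardsC [set y : 'I_n | y %% r.+1 == x %% r.+1]) mulnDr addnC.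
apply: leq_add; last exact: card_residue_class.
rewrite leq_mul2l; apply: subset_leq_card; apply/subsetP => y.
by rewrite !inE in_cross cE eq_sym.
Qed.

Lemma turan_gt0 n r : 1 < r -> r < n -> 0 < turan n (complete r.+1).
Proof.
move=> r1 rn; have := turan_lower n (ltnW r1); rewrite lt0n.
case: eqP => // ->; nia.
Qed.

(** * The theorem of Erdos and Stone *)

Lemma injection_into (T : finType) (B : {set T}) t : t <= #|B| ->
  exists2 f : 'I_t -> T, injective f & forall a, f a \in B.
Proof.
move=> tB; exists (fun a => enum_val (widen_ord tB a)) => [a b|a]; last exact: enum_valP.
by move/enum_val_inj/(congr1 val) => /= /val_inj.
Qed.

(** The complete r-partite graph with t vertices in each part, mapped into the
    graph of e.  Injectivity is asked only within the parts: when e is irreflexive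
    the adjacencies make the parts disjoint. *)
Definition blowup (V : finType) (e : rel V) (A : {set V}) r t
    (h : 'I_r -> 'I_t -> V) : Prop :=
  [/\ forall i, injective (h i), forall i a, h i a \in A &
      forall i j a b, i != j -> e (h i a) (h j b)].

Definition nonnbrs (V : finType) (e : rel V) (A : {set V}) (x : V) : {set V} :=
  [set y in A | ~~ e x y].

Lemma large_fiber (T U : finType) (W : {set T}) (f : T -> U) t :
  #|U| * t < #|W| -> exists u, t <= #|[set x in W | f x == u]|.
Proof.
move=> lt; apply/existsP; apply: contraLR lt; rewrite negb_exists => /forallP sm.
rewrite -leqNgt -sum1_card (partition_big f predT) //= -sum_nat_const.
apply: leq_sum => u _; apply: ltnW; rewrite ltnNge.
apply: contra (sm u) => /leq_trans; apply; rewrite -sum1_card.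
by under [X in _ <= X]eq_bigl do rewrite inE.
Qed.

(** The hypothesis bounds the number of non-neighbours of each vertex of A by
    (1 - 1/q) #|A| / (r - 1).  To pass from r parts to r + 1, take a blow-up with
    r parts of size s = 2qt, and let W consist of the vertices of A with at least
    t neighbours in each part.  A vertex outside W has more than s - t
    non-neighbours in the blow-up, while each of the rs vertices of the blow-up
    has few non-neighbours in A; so W contains a fixed proportion 1/(2q - 1) of A.
    There are finitely many traces of neighbourhoods on the blow-up, hence t
    vertices of W have the same trace.  They form the new part, joined to t common
    neighbours in each old part. *)
Lemma blowup_of_min_degree r q t : 0 < q -> exists N,
  forall (V : finType) (e : rel V) (A : {set V}), symmetric e -> N <= #|A| ->
    {in A, forall x, r.-1 * q * #|nonnbrs e A x| + #|A| <= q * #|A|} ->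
  exists h : 'I_r -> 'I_t -> V, blowup e A h.
Proof.
move=> q0; have I0 (X : Type) : 'I_0 -> X by case.
elim: r t => [|r IH] t.
  by exists 0 => V e A _ _ _; exists (fun i => I0 _ i); split=> -[].
case: t => [|t].
  by exists 0 => V e A _ _ _; exists (fun _ => I0 _); split=> [i []|i []|i j []].
set s := 2 * q * t.+1; have [N HN] := IH s.
pose M := #|{ffun 'I_r -> {set 'I_s}}|.
exists (N + 2 * q * (M * t.+1).+1) => V e A esym nA deg.
have [|x xA|h [hi hA he]] := HN V e A esym; first by lia.
  apply: leq_trans (deg x xA); rewrite leq_add2r !leq_mul2r /=.
  by rewrite leq_pred !orbT.
pose S x := [ffun i : 'I_r => [set a : 'I_s | e x (h i a)]].
pose W := [set x in A | [forall i, t.+1 <= #|S x i|]].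
have WA : W \subset A by apply/subsetP => x; rewrite inE => /andP[].
have bigW : M * t.+1 < #|W|.
  (* L counts the non-adjacent pairs between A and the blow-up; L1 bounds it from
     below through A :\: W and L2 from above by the degree hypothesis. *)
  pose L := \sum_(x in A) \sum_(i < r) \sum_(a < s) ~~ e x (h i a).
  have L1 : (#|A| - #|W|) * (s - t.+1) <= L.
    rewrite -cardsDS // -sum_nat_const /L [X in _ <= X](big_setID W) /=.
    apply: leq_trans (leq_addl _ _); apply: leq_sum => x; rewrite !inE.
    move=> /andP[nW xA]; rewrite xA /= in nW.
    case/forallPn: nW => i; rewrite -ltnNge ffunE => lt.
    rewrite (bigD1 i) //=; apply: leq_trans (leq_addr _ _).
    rewrite leq_subLR.
    apply: (@leq_trans (#|[set a | e x (h i a)]| + \sum_(a < s) ~~ e x (h i a)));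
      last by rewrite leq_add2r ltnW.
    rewrite -{1}(card_ord s) -(cardsC [set a | e x (h i a)]) leq_add2l.
    rewrite -sum1_card big_mkcond /=; apply: leq_sum => a _.
    by rewrite !inE; case: (e _ _).
  have L2 : q * L + s * #|A| <= s * q * #|A|.
    have -> : L = \sum_(i < r) \sum_(a < s) #|nonnbrs e A (h i a)|.
      rewrite /L exchange_big /=; apply: eq_bigr => i _.
      rewrite exchange_big /=; apply: eq_bigr => a _.
      rewrite -sum1_card [RHS]big_mkcond [LHS]big_mkcond; apply: eq_bigr => x _.
      by rewrite inE esym; case: (_ \in _); case: (e _ _).
    (* With no part at all the degree hypothesis is void, but the sum is empty. *)
    have [r0|rpos] := posnP r.
      rewrite big1 ?muln0 ?add0n; last by move=> [i ilt]; exfalso; rewrite r0 in ilt.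
      by rewrite -mulnA leq_mul2l (leq_pmull _ q0) orbT.
    rewrite -(leq_pmul2l rpos) mulnDr mulnA big_distrr /=.
    have -> : r * (s * #|A|) = \sum_(i < r) \sum_(a < s) #|A|.
      by rewrite !sum_ord_const.
    have -> : r * (s * q * #|A|) = \sum_(i < r) \sum_(a < s) q * #|A|.
      by rewrite !sum_ord_const !mulnA.
    rewrite -big_split /=; apply: leq_sum => i _; rewrite big_distrr -big_split /=.
    by apply: leq_sum => a _; apply: deg.
  have := subset_leq_card WA.
  move: L1 L2 nA; rewrite /s; move: #|A| #|W| L (M * _) => n w l m.
  move=> L1 L2 nA wn.
  have E : 2 * q * t.+1 - t.+1 = (2 * q - 1) * t.+1 by rewrite mulnBl mul1n.
  rewrite E in L1.
  have : q * t.+1 * ((n - w) * (2 * q - 1)) + q * t.+1 * (2 * n) <= q * t.+1 * (2 * q * n) by nia.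
  rewrite -mulnDr leq_pmul2l ?muln_gt0 ?q0 //.
  by nia.
have [U tU] := large_fiber S bigW.
have [w wi wW] := injection_into tU.
have Ubig i : t.+1 <= #|U i|.
  have := wW ord0; rewrite !inE => /andP[/andP[_ /forallP/(_ i)]].
  by move=> ? /eqP <-.
have /fin_all_exists2[sel seli selU] : forall i, exists2 f : 'I_t.+1 -> 'I_s,
    injective f & forall a, f a \in U i.
  by move=> i; apply: injection_into.
have adj j a b : e (w a) (h j (sel j b)).
  by have := selU j b; have := wW a; rewrite !inE => /andP[_ /eqP <-]; rewrite ffunE inE.
exists (fun i a => if unlift ord_max i is Some j then h j (sel j a) else w a); split.
- by move=> i a b; case: unliftP => [j|] _; [move/hi/seli|move/wi].
- move=> i a; case: unliftP => [j|] _; first exact: hA.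
  by have := wW a; rewrite !inE => /andP[/andP[]].
move=> i j a b; case: unliftP => [i'|] ->; case: unliftP => [j'|] ->.
- by rewrite (inj_eq lift_inj); apply: he.
- by move=> _; rewrite esym; apply: adj.
- by move=> _; apply: adj.
- by rewrite eqxx.
Qed.

Definition sum_nonnbrs (V : finType) (e : rel V) (A : {set V}) : nat :=
  \sum_(x in A) #|nonnbrs e A x|.

Lemma sum_nonnbrs_del (V : finType) (e : rel V) (A : {set V}) (v : V) :
  symmetric e -> v \in A ->
  sum_nonnbrs e (A :\ v) + 2 * #|nonnbrs e A v| <= sum_nonnbrs e A + 1.
Proof.
move=> esym vA; rewrite /sum_nonnbrs [X in _ <= X + 1](big_setD1 v) //=.
have -> : \sum_(x in A :\ v) #|nonnbrs e A x| =
   \sum_(x in A :\ v) #|nonnbrs e (A :\ v) x| + \sum_(x in A :\ v) ~~ e x v.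
  rewrite -big_split /=; apply: eq_bigr => x _.
  rewrite (cardsD1 v (nonnbrs e A x)) inE vA addnC; congr (_ + _).
  by apply: eq_card => y; rewrite !inE andbA.
have : #|nonnbrs e A v| <= \sum_(x in A :\ v) ~~ e x v + 1.
  rewrite (cardsD1 v) addnC; apply: leq_add; last exact: leq_b1.
  rewrite -sum1_card big_mkcond [X in _ <= X]big_mkcond /=; apply: leq_sum => x _.
  by rewrite !inE esym; case: (x == v) => //=; case: (x \in A) => //=; case: (e x v).
lia.
Qed.

(** Deletes vertices with too many non-neighbours as long as there are any.  The
    quantity (q - 1) #|A|^2 - r q (sum of non-neighbours) does not decrease on
    the way, so that the surviving set B satisfies (q - 1) #|B|^2 >= X and
    cannot be small. *)
Lemma min_degree_subset (V : finType) (e : rel V) (A : {set V}) r q X :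
  symmetric e -> r * q * sum_nonnbrs e A + X <= q.-1 * #|A| ^ 2 ->
  exists2 B : {set V}, X <= q.-1 * #|B| ^ 2 &
    {in B, forall x, 2 * (r * q * #|nonnbrs e B x|) <= 2 * (q.-1 * #|B|) + r * q}.
Proof.
move=> esym; have [n] := ubnP #|A|; elim: n A => // n IH A; rewrite ltnS => An hA.
have [/forall_inP|] := boolP [forall x in A,
   2 * (r * q * #|nonnbrs e A x|) <= 2 * (q.-1 * #|A|) + r * q].
  by exists A => //; apply: leq_trans hA; apply: leq_addl.
rewrite negb_forall_in => /exists_inP[v vA]; rewrite -ltnNge => bad.
have cA := cardsD1 v A; rewrite vA in cA.
apply: (IH (A :\ v)); first by lia.
have := sum_nonnbrs_del esym vA; move: cA bad hA; rewrite !expnS expn0 !muln1.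
move: #|A| #|_ :\ _| #|nonnbrs _ _ _| (sum_nonnbrs e A) (sum_nonnbrs e (A :\ v)) (q.-1).
move: (r * q) => p a b d sA sB q' -> bad hA hd.
have : p * (sB + 2 * d) <= p * (sA + 1) by rewrite leq_mul2l hd orbT.
nia.
Qed.

(** The density hypothesis leaves a margin for q; replacing q by 2q in the
    deletion makes X = #|V|^2 available there, so the set B obtained has size
    proportional to #|V|, and replacing q by 4q absorbs the additive error in its
    minimum degree. *)
Lemma erdos_stone r q t : 0 < q -> exists N,
  forall (V : finType) (e : rel V), symmetric e -> N <= #|V| ->
    r * q * sum_nonnbrs e setT + #|V| ^ 2 <= q * #|V| ^ 2 ->
  exists h : 'I_r.+1 -> 'I_t -> V, blowup e setT h.
Proof.
move=> q0; have q40 : 0 < 2 * (2 * q) by lia.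
have [N HN] := @blowup_of_min_degree r.+1 (2 * (2 * q)) t q40.
exists (2 * q * (N + r * (2 * q))) => V e esym nV hV.
have [|B hB dB] := @min_degree_subset V e setT r (2 * q) (#|V| ^ 2) esym.
  rewrite cardsT; move: hV; move: (sum_nonnbrs _ _) (#|V| ^ 2) => S X.
  by nia.
have NB : N + r * (2 * q) <= #|B|.
  rewrite leqNgt; apply/negP => lt.
  have nV2 := leq_mul nV nV; move: hB; rewrite -mulnn -mulnn leqNgt => /negP; apply.
  apply: leq_trans nV2; rewrite mulnACA.
  apply: (@leq_ltn_trans (2 * q * (2 * q) * (#|B| * #|B|))).
    by rewrite leq_mul2r; nia.
  by rewrite ltn_pmul2l ?ltn_mul //; nia.
have [|x xB|h [hi _ he]] := HN V e B esym; first by lia.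
  have := dB x xB; rewrite /=; nia.
by exists h; split=> // i a; rewrite inE.
Qed.

(** * The number f(n, G | F) *)

Definition good_copy (n : nat) (G : sgraph) (F : sgraph -> Prop)
    (c : {set 'I_n} -> nat) : Prop :=
  exists h : G -> 'I_n, injective h /\
    forall e, e \in copy_edges h -> F (spanned (color_class c h (c e))).

Lemma num_colors_le n (c : {set 'I_n} -> nat) : num_colors c <= #|edges (complete n)|.
Proof. by rewrite /num_colors (leq_trans (size_undup _)) // size_map -cardE. Qed.

Lemma fcolP n (G : sgraph) F (c : {set 'I_n} -> nat) :
  fcol n G F <= num_colors c -> good_copy G F c.
Proof.
have [|h _] := @nat_minP [set m | forall c : {set 'I_n} -> nat,
   m <= num_colors c -> good_copy G F c]%classic; last exact: h.
by exists #|edges (complete n)|.+1 => c'; rewrite leqNgt ltnS num_colors_le.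
Qed.

Lemma lt_fcol n (G : sgraph) F m : m < fcol n G F ->
  exists2 c : {set 'I_n} -> nat, m <= num_colors c & ~ good_copy G F c.
Proof.
move=> lt; apply: contrapT => no; move: lt; rewrite ltnNge => /negP; apply.
by apply: nat_min_le => c mc; apply: contrapT => ng; apply: no; exists c.
Qed.

(** * The lower bound *)

(** The colouring that gives distinct colours to the edges of a complete r-partite
    graph and a single further colour to all the others has no good copy of G. *)
Lemma fcol_lower (G : sgraph) F r n :
  graph_family F -> 0 < r -> chi G = r.+1 -> chiF F G = r.+1 -> #|G| <= n ->
  turan n (complete r.+1) + 2 <= fcol n G F.
Proof.
move=> Ff r0 chG chFG Gn; have [col colT] := turan_le_cross n r0.
apply: leq_trans (_ : #|cross col| + 2 <= _); first by rewrite leq_add2r.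
rewrite leqNgt; apply/negP => lt.
pose c (A : {set 'I_n}) : nat := if A \in cross col then (enum_rank A).+1 else 0.
have K2 (A : {set 'I_n}) : A \in edges (complete n) = (#|A| == 2) by rewrite !inE.
have crossK : cross col \subset edges (complete n).
  by apply/subsetP => A /card_cross A2; rewrite K2 A2.
have rn : r < n by rewrite (leq_trans _ Gn) // -chG chi_le_card.
have [A0 A0K A0c] : exists2 A : {set 'I_n}, A \in edges (complete n) & A \notin cross col.
  apply: contrapT => no; have := @cross_complete_free _ r n col rn; apply.
  apply: (@contains_complete _ _ n id) => // i j ij; apply: contrapT => /negP nc.
  by apply: no; exists [set i; j]; rewrite // K2 cards2 ij.
(* A0 stands for all the edges with the further colour. *)
have ci : {in A0 |: cross col &, injective c}.
  move=> A B /setU1P[->|Ac] /setU1P[->|Bc] //.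
  - by rewrite /c (negbTE A0c) Bc.
  - by rewrite /c (negbTE A0c) Ac.
  - by rewrite /c Ac Bc => -[] /val_inj /enum_rank_inj.
have colors : #|cross col| + 1 <= num_colors c.
  have <- : #|A0 |: cross col| = #|cross col| + 1 by rewrite cardsU1 A0c addnC.
  rewrite cardE -(size_map c); apply: uniq_leq_size => [|a].
    rewrite map_inj_in_uniq ?enum_uniq // => A B.
    by rewrite !mem_enum; apply: ci.
  rewrite mem_undup => /mapP[A]; rewrite mem_enum => Ain ->; apply/mapP; exists A => //.
  by rewrite mem_enum; case/setU1P: Ain => [->|/(subsetP crossK)].
have [|h [hi hF]] := @fcolP n G F c; first by lia.
pose D := [set A in edges G | h @: A \notin cross col].
have DG : D \subset edges G by apply/subsetP => A; rewrite inE => /andP[].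
have D2 A : A \in D -> #|A| = 2 by move/(subsetP DG)/card_edge.
have : chi (delete_edges D) <= r.
  apply: (@chi_le (delete_edges D) r (col \o h)) => x y; rewrite edges_delete !inE => /andP[+ xy].
  by rewrite xy /= negbK imset_set2 in_cross => /eqP.
have [D0|/set0Pn[A AD]] := eqVneq D set0.
  move=> _; have : chi G <= r; last by rewrite chG ltnn.
  apply: (@chi_le G r (col \o h)) => x y xy.
  have : h @: [set x; y] \in cross col; last by rewrite imset_set2 in_cross => /eqP.
  by have := in_set0 [set x; y]; rewrite -D0 inE xy => /negbT; rewrite negbK.
have := AD; rewrite inE => /andP[AG Anc].
apply/negP; rewrite -ltnNge -chFG; apply: chiF_le DG _.
have := hF (h @: A) (imset_f _ AG).
have -> : color_class c h (c (h @: A)) = [set h @: B | B : {set G} in D].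
  apply/setP => B; rewrite !inE {2}/c (negbTE Anc).
  apply/andP/imsetP => [[/imsetP[C CG ->]]|[C]].
    by rewrite /c; case: ifPn => // nc _; exists C; rewrite // inE CG.
  by rewrite inE => /andP[CG nc] ->; rewrite /c (negbTE nc) imset_f.
by apply: Ff.2; apply/isomorphic_sym/isomorphic_spanned.
Qed.

(** * The upper bound *)

Lemma rainbow_edges n (c : {set 'I_n} -> nat) : exists E : {set {set 'I_n}},
  [/\ E \subset edges (complete n), num_colors c <= #|E| & {in E &, injective c}].
Proof.
pose K := edges (complete n).
(* The pick depends on the colour alone, so edges of equal colour have the same
   representative. *)
pose rep a := [pick e in K | c e == a].
exists [set e in K | rep (c e) == Some e]; split.
- by apply/subsetP => e; rewrite inE => /andP[].
- rewrite /num_colors cardE -(size_map c); apply: uniq_leq_size (undup_uniq _) _ => a.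
  rewrite mem_undup => /mapP[e]; rewrite mem_enum => eK ->.
  have : rep (c e) = rep (c e) by [].
  rewrite {1}/rep; case: pickP => [f /andP[fK /eqP cf] E|/(_ e)]; last first.
    by rewrite /= eqxx andbT -/K eK.
  by apply/mapP; exists f => //; rewrite mem_enum inE -/K fK cf -E eqxx.
move=> e f; rewrite !inE => /andP[_ /eqP re] /andP[_ /eqP rf] E.
by move: re; rewrite E rf => -[].
Qed.

(** Vertices of colour i in an optimal colouring of G are sent into the i-th part
    of the blow-up. *)
Lemma good_copy_of_blowup n (G : sgraph) F (c : {set 'I_n} -> nat) (E : {set {set 'I_n}})
    (h : 'I_(chi G) -> 'I_#|G| -> 'I_n) :
  graph_family F -> F (complete 2) -> (forall A, A \in E -> #|A| = 2) ->
  {in E &, injective c} -> blowup (fun x y => [set x; y] \in E) setT h ->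
  good_copy G F c.
Proof.
move=> Ff F2 E2 ci [hi _ he]; have [col colP] := chiP G.
pose g x := h (col x) (enum_rank x).
have gE x y : [set x; y] \in edges G -> [set g x; g y] \in E.
  by move=> /colP /eqP; apply: he.
have copyE e : e \in copy_edges g -> e \in E.
  case/imsetP => A AG ->; have [x [y [_ AE]]] := edgeP AG.
  by rewrite AE imset_set2 gE // -AE.
exists g; split.
  move=> x y; rewrite /g; have [->|ne] := eqVneq (col x) (col y).
    by move/hi/enum_rank_inj.
  move=> eq; have /E2 := he _ _ (enum_rank x) (enum_rank y) ne.
  by rewrite eq setUid cards1.
move=> e eg; have -> : color_class c g (c e) = [set e].
  apply/setP => f; rewrite !inE; apply/andP/eqP => [[fg /eqP cf]|->]; last by rewrite eqxx.
  by apply: ci cf; apply: copyE.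
by apply: family_single_edge => //; apply/E2/copyE.
Qed.

Lemma sum_nonnbrs_edges (V : finType) (E : {set {set V}}) :
  (forall A, A \in E -> #|A| = 2) ->
  sum_nonnbrs (fun x y => [set x; y] \in E) setT + 2 * #|E| = #|V| ^ 2.
Proof.
move=> E2; rewrite -handshake // /sum_nonnbrs (eq_bigl xpredT) => [|x]; last by rewrite inE.
rewrite -big_split /= -mulnn -sum_nat_const; apply: eq_bigr => x _.
rewrite -(cardsC [set y | [set x; y] \in E]) addnC; congr (_ + _).
by apply: eq_card => y; rewrite !inE.
Qed.

(** With one colour fewer than f(n, G | F) some colouring has no good copy, so its
    rainbow subgraph has too few edges for the theorem of Erdos and Stone.  Hence
    f(n, G | F) is at most n^2 (1 - 1/r + 1/(qr)) / 2 + 1, and comparison with the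
    lower bound on the Turan number gives the claim, because the errors n^2 / q and n
    are both small against it. *)
Lemma fcol_upper (G : sgraph) F r q :
  graph_family F -> F (complete 2) -> 1 < r -> chi G = r.+1 -> 0 < q ->
  exists N, forall n, N <= n -> q * fcol n G F <= (q + 3) * turan n (complete r.+1).
Proof.
move=> Ff F2 r1 chG q0; have [N HN] := @erdos_stone r q #|G| q0.
exists (N + (3 * q + 3)) => n nN.
have [->|] := posnP (fcol n G F); first by rewrite muln0.
move=> f0; have [|c mc ng] := @lt_fcol n G F (fcol n G F).-1; first by rewrite ltn_predL.
have [E [EK cE ci]] := rainbow_edges c.
have E2 A : A \in E -> #|A| = 2 by move/(subsetP EK)/card_edge.
have many : q * n ^ 2 < r * q * sum_nonnbrs (fun x y => [set x; y] \in E) setT + n ^ 2.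
  rewrite ltnNge; apply/negP => few; apply: ng.
  have [|||] := HN 'I_n (fun x y => [set x; y] \in E); rewrite ?card_ord //.
  - by move=> x y; rewrite setUC.
  - by apply: leq_trans nN; apply: leq_addr.
  by rewrite -chG => h; apply: good_copy_of_blowup.
have := sum_nonnbrs_edges E2; rewrite card_ord.
have := turan_lower n (ltnW r1).
have : fcol n G F <= #|E| + 1 by lia.
move: many nN; rewrite -!mulnn.
move: (sum_nonnbrs _ _) (turan _ _) #|E| (fcol _ _ _) => S T m f many nN fm tl Sm.
(* h2, h3 and h1 give 2rqf <= 2rqT + 2rq + qrn + n^2; the last three terms are at
   most 6rT, by tl, h5 and h6; h4 holds because n >= 3q + 3. *)
have h1 : r * q * (S + 2 * m) = r * q * (n * n) by rewrite Sm.
have h2 : q * (r * (n * n)) <= q * (2 * (r * T) + n * n + r * n) by rewrite leq_mul2l tl orbT.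
have h3 : 2 * r * q * f <= 2 * r * q * (m + 1) by rewrite leq_mul2l fm orbT.
have h4 : 2 * q + (q + 3) * n <= n * n by nia.
have h5 : r * (2 * q + (q + 3) * n) <= r * (n * n) by rewrite leq_mul2l h4 orbT.
have h6 : 2 * (n * n) <= r * (n * n) by rewrite leq_mul2r r1 orbT.
have h7 : 2 * r * (q * f) <= 2 * r * ((q + 3) * T) by lia.
by move: h7; rewrite leq_pmul2l // muln_gt0 /=; lia.
Qed.

(** * Graphs whose chromatic number survives deletions *)

(** The line y = a + i b, restricted to the columns i < k. *)
Definition line (k p : nat) (ab : 'F_p * 'F_p) (i : 'I_k) : 'I_k * 'F_p :=
  (i, ab.1 + i%:R * ab.2)%R.

Lemma line_eq (k p : nat) (ab cd : 'F_p * 'F_p) (i j : 'I_k) :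
  prime p -> k <= p -> i != j -> line ab i = line cd i -> line ab j = line cd j ->
  ab = cd.
Proof.
move=> p_prime k_le_p; case: ab cd => [a b] [c d] ij /(congr1 snd) Ei /(congr1 snd) Ej.
have {}Ei : (a + i%:R * b = c + i%:R * d)%R := Ei.
have {}Ej : (a + j%:R * b = c + j%:R * d)%R := Ej.
have ijF : (i%:R - j%:R : 'F_p)%R != 0%R.
  rewrite subr_eq0; apply: contra ij => /eqP/(congr1 val) /=.
  by rewrite !val_Fp_nat // !modn_small ?(leq_trans (ltn_ord _)) // => /val_inj ->.
have bd : b = d.
  apply: (mulfI ijF).
  have -> : ((i%:R - j%:R) * b = (a + i%:R * b) - (a + j%:R * b))%R by ring.
  by rewrite Ei Ej; ring.
by congr (_, _) => //; move: Ei; rewrite bd => /addIr.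
Qed.

(** If each of the p^2 lines had two points joined by an edge in D, these edges
    would be distinct, since two points in distinct columns determine the line. *)
Lemma line_avoiding (k p : nat) (D : {set {set 'I_k * 'F_p}}) :
  prime p -> k <= p -> #|D| < p ^ 2 ->
  exists ab, forall i j : 'I_k, i != j -> [set line ab i; line ab j] \notin D.
Proof.
move=> p_prime k_le_p small; apply: contrapT => no.
have /fin_all_exists[phi phiP] : forall ab, exists A : {set 'I_k * 'F_p},
    A \in D /\ exists i j : 'I_k, i != j /\ A = [set line ab i; line ab j].
  move=> ab; apply: contrapT => nA; apply: no; exists ab => i j ij.
  by apply/negP => AD; apply: nA; exists [set line ab i; line ab j]; split=> //; exists i, j.
have phi_inj : injective phi.
  move=> ab cd E; have [_ [i [j [ij Eab]]]] := phiP ab.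
  have [_ [i' [j' [ij' Ecd]]]] := phiP cd.
  move: E; rewrite Eab Ecd => /set2_eq[[Ei Ej]|[Ei Ej]].
    have ii' : i' = i by have := congr1 fst Ei.
    have jj' : j' = j by have := congr1 fst Ej.
    by subst i' j'; apply: line_eq p_prime k_le_p ij Ei Ej.
  have ii' : j' = i by have := congr1 fst Ei.
  have jj' : i' = j by have := congr1 fst Ej.
  by subst i' j'; apply: line_eq p_prime k_le_p ij Ei Ej.
move: small; rewrite ltnNge => /negP; apply.
have -> : p ^ 2 = #|[set phi ab | ab in setT]|.
  by rewrite card_imset // cardsT card_prod card_Fp // mulnn.
by apply: subset_leq_card; apply/subsetP => A /imsetP[ab _ ->]; have [] := phiP ab.
Qed.

Definition big_multipartite (k p : nat) : sgraph := mkgraph (cross (@fst 'I_k 'F_p)).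

Lemma edges_big_multipartite (k p : nat) :
  edges (big_multipartite k p) = cross (@fst 'I_k 'F_p).
Proof. exact/edges_mkgraph/card_cross. Qed.

Lemma card_big_multipartite (k p : nat) : prime p -> #|big_multipartite k p| = k * p.
Proof. by move=> p_prime; rewrite card_prod card_ord card_Fp. Qed.

(** A proper colouring is injective on a line that D does not meet. *)
Lemma colors_after_deletion (k p : nat) (D : {set {set 'I_k * 'F_p}}) m (c : 'I_k * 'F_p -> 'I_m) :
  prime p -> k <= p -> #|D| < p ^ 2 ->
  (forall x y, [set x; y] \in cross fst :\: D -> c x <> c y) -> k <= m.
Proof.
move=> p_prime k_le_p small cP; have [ab abP] := line_avoiding p_prime k_le_p small.
have ci : injective (c \o line ab).
  move=> i j /= E; apply/eqP; apply: contraT => ij; exfalso.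
  by apply: (cP (line ab i) (line ab j)) => //; rewrite inE abP // in_cross.
by have := leq_card _ ci; rewrite !card_ord.
Qed.

Lemma chi_big_multipartite_del (k p : nat) (D : {set {set big_multipartite k p}}) :
  prime p -> k <= p -> #|D| < p ^ 2 ->
  chi (delete_edges D) = k.
Proof.
move=> p_prime k_le_p small; apply/eqP; rewrite eqn_leq; apply/andP; split.
  apply: (@chi_le (delete_edges D) k fst) => x y.
  by rewrite edges_delete edges_big_multipartite inE in_cross => /andP[_ /eqP].
have [c cP] := chiP (delete_edges D).
apply: (colors_after_deletion (c := c) p_prime k_le_p small) => x y xy; apply: cP.
by rewrite edges_delete edges_big_multipartite.
Qed.

Lemma chi_big_multipartite (k p : nat) : prime p -> k <= p ->
  chi (big_multipartite k p) = k.
Proof.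
move=> p_prime k_le_p.
apply/eqP; rewrite eqn_leq; apply/andP; split.
  apply: (@chi_le (big_multipartite k p) k fst) => x y.
  by rewrite edges_big_multipartite in_cross => /eqP.
have [c cP] := chiP (big_multipartite k p).
apply: (colors_after_deletion (D := set0) (c := c)) => //.
  by rewrite cards0 expn_gt0 prime_gt0.
by move=> x y; rewrite setD0 => xy; apply: cP; rewrite edges_big_multipartite.
Qed.

(** A member D of F inside the graph has fewer than p^2 edges: if it has more than
    n0 vertices this is the sparsity hypothesis, as it has at most kp of them, and
    otherwise it has at most n0^2 edges. *)
Lemma chiF_big_multipartite (k p : nat) F n0 :
  prime p -> k <= p -> graph_family F -> F (complete 2) -> 1 < k -> n0 < p ->
  (forall n, n0 < n -> k ^ 2 * max_edges F n < n ^ 2) ->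
  chiF F (big_multipartite k p) = k.
Proof.
move=> p_prime k_le_p Ff F2 k1 n0p sparse.
pose G := big_multipartite k p.
have [|] := @nat_minP [set chi (delete_edges D) |
   D in [set D : {set {set G}} | D \subset edges G /\ F (spanned D)]]%classic.
  have x0 : 'F_p := 0%R.
  pose e : {set G} := [set (Ordinal (ltnW k1), x0); (Ordinal k1, x0)].
  have eE : e \in edges G by rewrite edges_big_multipartite in_cross.
  exists (chi (delete_edges [set e])); exists [set e] => //; split; first by rewrite sub1set.
  by apply: family_single_edge => //; apply: card_edge eE.
rewrite -/(chiF F _) => -[D [DG FD] <-] _; apply: chi_big_multipartite_del => //.
have D2 A : A \in D -> #|A| = 2 by move/(subsetP DG)/card_edge.
rewrite -card_edges_spanned //; set H := spanned D in FD *.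
have Hkp : #|H| <= k * p.
  by rewrite -(card_big_multipartite k p_prime) card_sig max_card.
have [Hn0|n0H] := leqP #|H| n0.
  apply: (@leq_ltn_trans (#|H| ^ 2)); last by rewrite ltn_exp2r // (leq_ltn_trans Hn0).
  apply: (@leq_trans (2 * #|edges H|)); first by rewrite leq_pmull.
  rewrite -handshake => [|A /card_edge //].
  by rewrite -mulnn -sum_nat_const; apply: leq_sum => x _; apply: max_card.
rewrite -(ltn_pmul2l (_ : 0 < k ^ 2)) ?expn_gt0 ?(ltnW k1) // -expnMn.
apply: leq_trans (_ : #|H| ^ 2 <= _); last by rewrite leq_exp2r.
apply: leq_ltn_trans (sparse _ n0H).
by rewrite leq_mul2l card_edges_le_max // orbT.
Qed.

(** An increasing sequence of primes gives graphs of distinct orders. *)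
Lemma infinitely_many_graphs F k n0 : graph_family F -> F (complete 2) -> 1 < k ->
  (forall n, n0 < n -> k ^ 2 * max_edges F n < n ^ 2) ->
  exists Gs : nat -> sgraph,
    (forall i j : nat, i <> j -> ~ isomorphic (Gs i) (Gs j)) /\
    (forall i : nat, chiF F (Gs i) = k /\ chi (Gs i) = k).
Proof.
move=> Ff F2 k1 sparse.
pose next m := s2val (prime_above m).
have next_gt m : m < next m by rewrite /next; case: prime_above.
have next_prime m : prime (next m) by rewrite /next; case: prime_above.
pose p i := next (iter i next (k + n0)).
have p_prime i : prime (p i) by apply: next_prime.
have pS i : p i < p i.+1 by apply: next_gt.
have plt : {homo p : i j / i < j} by apply: homo_ltn; first exact: ltn_trans.
have p_big i : k + n0 < p i.
  by elim: i => [|i /ltn_trans]; [apply: next_gt|apply; apply: pS].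
exists (fun i => big_multipartite k (p i)); split=> [i j ij [f [f_bij _]]|i].
  have := bij_eq_card f_bij; rewrite !card_big_multipartite ?next_prime //.
  move/eqP; rewrite eqn_pmul2l ?(ltnW k1) // => /eqP E.
  by case: (ltngtP i j) => // /plt; rewrite E ltnn.
have kp : k <= p i by apply: leq_trans (ltnW (p_big i)); apply: leq_addr.
split; last by apply: chi_big_multipartite.
by apply: (@chiF_big_multipartite _ _ F n0) => //; apply: leq_ltn_trans (p_big i); apply: leq_addl.
Qed.

(** * The ratio of f(n, G | F) to the Turan number *)

Local Open Scope classical_set_scope.
Local Open Scope ring_scope.

Theorem theorem5p1 (R : realType) (k : nat) (F : sgraph -> Prop)
    (k_ge3 : (3 <= k)%N)
    (F_family : graph_family F)
    (F_K2 : F (complete 2))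
    (F_sparse : exists n0 : nat, forall n : nat, (n0 < n)%N ->
       (max_edges F n)%:R < n%:R ^+ 2 / k%:R ^+ 2 :> R) :
  (exists Gs : nat -> sgraph,
     (forall i j : nat, i <> j -> ~ isomorphic (Gs i) (Gs j)) /\
     (forall i : nat, chiF F (Gs i) = k /\ chi (Gs i) = k)) /\
  (forall G : sgraph, chiF F G = k -> chi G = k ->
     (forall n : nat, (#|G| <= n)%N ->
        (turan n (complete k) + 2 <= fcol n G F)%N) /\
     (exists2 eps : nat -> R, eps n @[n --> \oo] --> (0 : R) &
        forall n : nat, (#|G| <= n)%N ->
          (fcol n G F)%:R <= (1 + eps n) * (turan n (complete k))%:R)).
Proof.
have k1 : (1 < k)%N by apply: leq_trans k_ge3.
split.
  have [n0 sparse] := F_sparse.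
  apply: (@infinitely_many_graphs F k n0) => // n /sparse.
  rewrite ltr_pdivlMr ?exprn_gt0 ?ltr0n ?(ltnW k1) // mulrC.
  by rewrite -!natrX -natrM ltr_nat.
case: k k_ge3 k1 F_sparse => // r r1 _ _ G chFG chG.
have low n : (#|G| <= n)%N -> (turan n (complete r.+1) + 2 <= fcol n G F)%N.
  by apply: fcol_lower => //; apply: ltnW.
split=> //.
have Tpos n : (#|G| <= n)%N -> 0 < (turan n (complete r.+1))%:R :> R.
  move=> Gn; rewrite ltr0n turan_gt0 //.
  by apply: leq_trans Gn; rewrite -chG chi_le_card.
exists (fun n => (fcol n G F)%:R / (turan n (complete r.+1))%:R - 1); last first.
  by move=> n /Tpos Tn; rewrite addrC subrK divfK // gt_eqF.
apply/cvgrPdist_le => e e0.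
(* The error 3/q of the upper bound has to be at most e. *)
pose q := (Num.truncn (3 / e)).+1.
have qe : 3 <= e * q%:R.
  rewrite mulrC -ler_pdivrMr // ltW //; apply: Num.Theory.truncnS_gt.
have [N HN] := @fcol_upper G F r q F_family F_K2 r1 chG isT.
exists (N + #|G|)%N => // n /= Nn.
have Gn : (#|G| <= n)%N by apply: leq_trans Nn; apply: leq_addl.
have Tn := Tpos n Gn.
rewrite sub0r normrN ger0_norm; last first.
  rewrite subr_ge0 ler_pdivlMr // mul1r ler_nat.
  by apply: leq_trans (low n Gn); apply: leq_addr.
rewrite lerBlDr ler_pdivrMr //.
have := HN n (leq_trans (leq_addr _ _) Nn); rewrite -(ler_nat R) !natrM natrD => up.
have q0 : 0 < q%:R :> R by rewrite ltr0n.
rewrite -(ler_pM2l q0); apply: le_trans up _.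
by rewrite mulrA ler_wpM2r ?(ltW Tn) // mulrDr mulr1 addrC lerD2r mulrC.
Qed.
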